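(* Let $\mathbb{D}=\{z\in\mathbb{C}:|z|<1\}$. Suppose the functions $f,g,h$, analytic in $\mathbb{D}$, satisfy $f(z)=g(z)\,h(\varphi(z))$ for $z\in\mathbb{D}$, for some Schwarz function $\varphi$. Further suppose that $|g(z)|\le b$ for $|z|<1$. Then $$B_r(f')\le b\left(2B_r(h)+B_r(h')\right)$$ holds for $0\le r\le r_2$, where $r_2=1-\sqrt{\frac23}$.
   Context: For $u(z)=\sum_{n=0}^{\infty}c_nz^n$ analytic in $\mathbb{D}$, the Bohr operator is $B_r(u)=\sum_{n=0}^{\infty}|c_n|r^n$ for $0\le r<1$. A Schwarz function is an analytic function $\varphi:\mathbb{D}\to\mathbb{D}$ with $\varphi(0)=0$. *)

(* Defs.v *)
(* Stdlib world: concrete reals R, Coquelicot's complex numbers C. *)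
From Stdlib Require Import Reals ClassicalEpsilon.
From Coquelicot Require Import Coquelicot.

Open Scope R_scope.

Definition in_disk (z : C) : Prop := Cmod z < 1.

(* u(z) = sum_n c_n z^n on the open unit disk. *)
Definition has_expansion (u : C -> C) (c : nat -> C) : Prop :=
  forall z : C, in_disk z -> @is_pseries C_AbsRing C_NormedModule c z (u z).

Definition analytic_in_disk (u : C -> C) : Prop :=
  exists c : nat -> C, has_expansion u c.

(* For u analytic in the disk the sequence c with u(z) = sum_n c_n z^n is unique,
   so the choice made by epsilon is immaterial; for other u the value is junk. *)
Definition coeffs (u : C -> C) : nat -> C :=
  epsilon (inhabits (fun _ : nat => RtoC 0)) (has_expansion u).

(* For u analytic in the disk and 0 <= r < 1 the series converges, so the total
   operator Series returns its sum. *)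
Definition Bohr (r : R) (u : C -> C) : R :=
  Series (fun n => Cmod (coeffs u n) * r ^ n).

Definition Schwarz_function (phi : C -> C) : Prop :=
  analytic_in_disk phi /\
  (forall z : C, in_disk z -> in_disk (phi z)) /\
  phi (RtoC 0) = RtoC 0.

(* Main.v *)
Require Import Defs.
From Stdlib Require Import Reals Lra Lia ZArith ClassicalEpsilon.
From Coquelicot Require Import Coquelicot.
Open Scope R_scope.

(** Write h = sum h_n w^n.  Then f = sum_n h_n g phi^n, and since phi(0) = 0 the
    function g phi^n starts at order n, so that the m-th coefficient of f is the
    finite sum over n <= m of h_n q_(n,m), where q_(n,m) is the m-th coefficient
    of g phi^n ([subordination_coefficients]).  It therefore suffices to bound
    each B_r((g phi^n)') by b (2 r^n + n r^(n-1)): weighting by |h_n| and summing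
    over n gives exactly b (2 B_r(h) + B_r(h')).

    The bound for one n ([weighted_power_majorant]) rests on the inequality
    |q_(n,n)| + |q_(n,n+k)| / 2 <= b for k >= 1 ([coefficient_pair_bound]).  It
    says |q_(n,n+k)| <= 2 (b - |q_(n,n)|): when the leading coefficient is almost
    as large as b, all the others are small.  Hence the excess of
    B_r((g phi^n)') over n |q_(n,n)| r^(n-1) is at most b - |q_(n,n)| times an
    arithmetico-geometric series in r.  For r <= 1/5 that series is small enough
    to be absorbed, and 1 - sqrt(2/3) < 1/5.

    The coefficient inequality is a Fejer kernel argument.  If
    W(t) = 1 + Re(xi e^(-ikt)) with |xi| = 1, then W >= 0 has mean 1, so the mean
    of W(t) e^(-int) u(rho e^(it)) is at most sup |u|; but this mean equals
    c_n rho^n + xi c_(n+k) rho^(n+k) / 2, up to a term in c_(n-k), which is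
    absent when u starts at order n.  Choosing xi to align the two terms and
    letting rho tend to 1 gives the claim.  The means are taken over roots of
    unity, after truncating the power series, so no integration is needed.  The
    choice k = n + 1, for which c_(n-k) does not exist, yields Cauchy's estimate
    ([cauchy_estimate]), from which uniqueness of expansions and the vanishing
    of coefficients of functions that are O(z^M) follow. *)

(** * Finite sums *)

(* Equations produced by generic sums live in the carrier of an algebraic
   structure; ring needs to see the concrete type. *)
Ltac Rring := change (?s = ?t) with (s = t :> R); ring.
Ltac Cring := change (?s = ?t) with (s = t :> C); ring.

Lemma Csum_S (a : nat -> C) n : sum_n a (S n) = Cplus (sum_n a n) (a (S n)) :> C.
Proof. exact (sum_Sn (G := C_AbelianMonoid) a n). Qed.

Lemma Rsum_S (a : nat -> R) n : sum_n a (S n) = sum_n a n + a (S n).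
Proof. exact (sum_Sn (G := R_AbelianMonoid) a n). Qed.

Lemma Re_sum (a : nat -> C) n : Re (sum_n a n) = sum_n (fun k => Re (a k)) n.
Proof.
  induction n; [now rewrite !sum_O|].
  rewrite Csum_S, Rsum_S, <- IHn; reflexivity.
Qed.

Lemma Im_sum (a : nat -> C) n : Im (sum_n a n) = sum_n (fun k => Im (a k)) n.
Proof.
  induction n; [now rewrite !sum_O|].
  rewrite Csum_S, Rsum_S, <- IHn; reflexivity.
Qed.

Lemma Cmod_sum_le (a : nat -> C) (b : nat -> R) n :
  (forall k, (k <= n)%nat -> Cmod (a k) <= b k) -> Cmod (sum_n a n) <= sum_n b n.
Proof.
  induction n; intros H.
  - rewrite !sum_O; apply H; lia.
  - rewrite Csum_S, Rsum_S. eapply Rle_trans; [apply Cmod_triangle|].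
    apply Rplus_le_compat; [apply IHn; intros; apply H; lia|apply H; lia].
Qed.

Lemma Rsum_le (a b : nat -> R) n :
  (forall k, (k <= n)%nat -> a k <= b k) -> sum_n a n <= sum_n b n.
Proof.
  induction n; intros H.
  - rewrite !sum_O; apply H; lia.
  - rewrite !Rsum_S. apply Rplus_le_compat; [apply IHn; intros; apply H; lia|apply H; lia].
Qed.

Lemma Csum_mult_l (x : C) (a : nat -> C) n :
  sum_n (fun k => Cmult x (a k)) n = Cmult x (sum_n a n).
Proof. exact (sum_n_mult_l (K := C_Ring) x a n). Qed.

Lemma Rsum_mult_l (x : R) (a : nat -> R) n :
  sum_n (fun k => x * a k) n = x * sum_n a n.
Proof. exact (sum_n_mult_l (K := R_Ring) x a n). Qed.

Lemma Csum_plus (a b : nat -> C) n :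
  sum_n (fun k => Cplus (a k) (b k)) n = Cplus (sum_n a n) (sum_n b n).
Proof. exact (sum_n_plus (G := C_AbelianMonoid) a b n). Qed.

Lemma Rsum_plus (a b : nat -> R) n :
  sum_n (fun k => a k + b k) n = sum_n a n + sum_n b n.
Proof. exact (sum_n_plus (G := R_AbelianMonoid) a b n). Qed.

Lemma Csum_single (x : C) p n : (p <= n)%nat ->
  sum_n (fun k => if Nat.eqb k p then x else RtoC 0) n = x :> C.
Proof.
  assert (Z : forall m, (m < p)%nat ->
    sum_n (fun k => if Nat.eqb k p then x else RtoC 0) m = RtoC 0 :> C).
  { induction m; intros Hm.
    - rewrite sum_O. destruct (Nat.eqb_spec 0 p); [lia|reflexivity].
    - rewrite Csum_S, IHm by lia. destruct (Nat.eqb_spec (S m) p); [lia|ring]. }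
  induction n; intros H.
  - rewrite sum_O. destruct (Nat.eqb_spec 0 p); [reflexivity|lia].
  - rewrite Csum_S. destruct (Nat.eqb_spec (S n) p).
    + rewrite Z by lia. ring.
    + rewrite IHn by lia. ring.
Qed.

(** * Complex series and power series *)

Definition Cseries (a : nat -> C) (l : C) : Prop :=
  @is_series C_AbsRing C_NormedModule a l.

(** Convergence in C is convergence in the product topology of R * R; this
    transfers results about real series to complex ones. *)
Lemma Cseries_Re_Im (a : nat -> C) (l : C) :
  Cseries a l <->
  is_series (fun k => Re (a k)) (Re l) /\ is_series (fun k => Im (a k)) (Im l).
Proof.
  unfold Cseries, is_series. split.
  - intros H; split; apply filterlim_locally; intros eps;
      generalize (proj1 (filterlim_locally _ _) H eps); apply filter_imp; intros n [H1 H2].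
    + rewrite <- Re_sum; exact H1.
    + rewrite <- Im_sum; exact H2.
  - intros [H1 H2]. apply filterlim_locally; intros eps.
    generalize (filter_and _ _ (proj1 (filterlim_locally _ _) H1 eps)
       (proj1 (filterlim_locally _ _) H2 eps)).
    apply filter_imp; intros n [K1 K2]. split.
    + change (ball (Re l) eps (Re (sum_n a n))). rewrite Re_sum; exact K1.
    + change (ball (Im l) eps (Im (sum_n a n))). rewrite Im_sum; exact K2.
Qed.

Lemma Cmod_series_le (a : nat -> C) (b : nat -> R) (l : C) :
  Cseries a l -> (forall k, Cmod (a k) <= b k) -> ex_series b -> Cmod l <= Series b.
Proof.
  intros Ha Hab Hb.
  assert (H1 : is_lim_seq (fun n => Cmod (sum_n a n)) (Cmod l)).
  { refine (filterlim_comp _ _ _ _ Cmod _ _ _ Ha _).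
    exact (@filterlim_norm C_AbsRing C_NormedModule l). }
  assert (H2 : is_lim_seq (fun n => sum_n b n) (Series b)) by exact (Series_correct b Hb).
  apply (is_lim_seq_le _ _ _ _ (fun n => Cmod_sum_le a b n (fun k _ => Hab k)) H1 H2).
Qed.

Lemma has_expansion_series u c z : has_expansion u c -> in_disk z ->
  Cseries (fun k => Cmult (c k) (Cpow z k)) (u z).
Proof.
  intros H Hz. apply is_series_ext with (2 := H z Hz).
  intros n. change (scal (pow_n z n) (c n)) with (Cmult (pow_n z n) (c n)).
  rewrite Cmult_comm. f_equal.
Qed.

Lemma series_has_expansion u c :
  (forall z, in_disk z -> Cseries (fun k => Cmult (c k) (Cpow z k)) (u z)) ->
  has_expansion u c.
Proof.
  intros H z Hz. apply is_series_ext with (2 := H z Hz).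
  intros n. change (scal (pow_n z n) (c n)) with (Cmult (pow_n z n) (c n)).
  rewrite Cmult_comm. f_equal.
Qed.

(** Convergence at a real point r < 1 makes the terms c_n r^n bounded, hence
    the radius of convergence of the moduli is at least r. This gives access to
    the theory of real power series, in particular to termwise derivatives. *)
Lemma CV_radius_has_expansion u c :
  has_expansion u c -> Rbar_le 1 (CV_radius (fun k => Cmod (c k))).
Proof.
  intros H.
  assert (K : forall r, 0 <= r < 1 -> Rbar_le r (CV_radius (fun k => Cmod (c k)))).
  { intros r Hr. apply (proj1 (CV_radius_bounded (fun k => Cmod (c k)))).
    assert (Hz : in_disk (RtoC r)).
    { unfold in_disk. rewrite Cmod_R, Rabs_pos_eq; lra. }
    pose proof (has_expansion_series _ _ _ H Hz) as S.
    apply Cseries_Re_Im in S. destruct S as [S1 S2].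
    assert (B : forall a : nat -> R, (exists l, is_series a l) -> exists M, forall n, Rabs (a n) <= M).
    { intros a Ha. destruct (filterlim_bounded a) as [M HM]; [|exists M; exact HM].
      exists 0. apply (ex_series_lim_0 a). exact Ha. }
    destruct (B _ (ex_intro _ _ S1)) as [M1 HM1].
    destruct (B _ (ex_intro _ _ S2)) as [M2 HM2].
    exists (sqrt 2 * Rmax M1 M2). intros n.
    replace (Rabs (Cmod (c n) * r ^ n)) with (Cmod (Cmult (c n) (Cpow (RtoC r) n))).
    2:{ rewrite Cmod_mult, Cmod_pow, Cmod_R, (Rabs_pos_eq r) by lra.
        symmetry. apply Rabs_pos_eq. apply Rmult_le_pos; [apply Cmod_ge_0|apply pow_le; lra]. }
    eapply Rle_trans; [apply Cmod_2Rmax|].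
    apply Rmult_le_compat_l; [apply sqrt_pos|].
    apply Rmax_case; [eapply Rle_trans; [apply HM1|apply Rmax_l]
      |eapply Rle_trans; [apply HM2|apply Rmax_r]]. }
  destruct (CV_radius (fun k => Cmod (c k))) as [x| |] eqn:E; simpl; auto.
  - apply Rnot_lt_le. intros Hx.
    assert (0 <= x) by (generalize (CV_radius_ge_0 (fun k => Cmod (c k))); rewrite E; auto).
    specialize (K ((x + 1) / 2)). simpl in K. lra.
  - exact (K 0 ltac:(lra)).
Qed.

Lemma ex_series_in_radius (a : nat -> R) r : Rbar_le 1 (CV_radius a) -> 0 <= r < 1 ->
  (forall k, 0 <= a k) -> ex_series (fun k => a k * r ^ k).
Proof.
  intros H Hr Ha. eapply ex_series_ext; [|apply (CV_disk_inside a r)].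
  - intros n. apply Rabs_pos_eq, Rmult_le_pos; [apply Ha|apply pow_le; lra].
  - eapply Rbar_lt_le_trans; [|exact H]. simpl. rewrite Rabs_pos_eq; lra.
Qed.

Lemma abs_summable u c r : has_expansion u c -> 0 <= r < 1 ->
  ex_series (fun k => Cmod (c k) * r ^ k).
Proof.
  intros H Hr. apply (ex_series_in_radius (fun k => Cmod (c k))); auto.
  - eapply CV_radius_has_expansion; eauto.
  - intros; apply Cmod_ge_0.
Qed.

Lemma has_expansion_ext u v c :
  (forall z, in_disk z -> u z = v z) -> has_expansion u c -> has_expansion v c.
Proof. intros E H z Hz. rewrite <- (E z Hz). apply H, Hz. Qed.

Lemma has_expansion_0 u c : has_expansion u c -> u (RtoC 0) = c 0%nat.
Proof.
  intros H. assert (Hz : in_disk (RtoC 0)) by (unfold in_disk; rewrite Cmod_0; lra).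
  pose proof (H _ Hz) as H1. 
  pose proof (@is_pseries_0 C_AbsRing C_NormedModule c) as H2.
  exact (filterlim_locally_unique _ _ _ H1 H2).
Qed.

Lemma shifted_summable u c rho n : has_expansion u c -> 0 < rho < 1 ->
  ex_series (fun j => Cmod (c (S n + j)%nat) * rho ^ j).
Proof.
  intros H Hr.
  apply ex_series_ext with (fun j => (/ rho ^ (S n)) * (Cmod (c (S n + j)%nat) * rho ^ (S n + j))).
  - intros j. rewrite pow_add.
    assert (rho ^ S n <> 0) by (apply pow_nonzero; lra).
    generalize dependent (rho ^ S n). intros p Hp.
    generalize (Cmod (c (S n + j)%nat)) (rho ^ j); intros x y.
    change (/ p * (x * (p * y)) = x * y :> R). field. exact Hp.
  - apply (ex_series_scal_l (V := R_NormedModule) (/ rho ^ (S n))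
      (fun j => Cmod (c (S n + j)%nat) * rho ^ (S n + j))).
    apply (ex_series_incr_n (fun j => Cmod (c j) * rho ^ j)). eapply abs_summable; eauto; lra.
Qed.

(** The constant is independent of z, so the estimate serves twice: as a
    uniform truncation error on a circle, and as O(z^(n+1)) near 0. *)
Lemma taylor_remainder u c rho n z : has_expansion u c -> 0 < rho < 1 -> Cmod z <= rho ->
  Cmod (u z - sum_n (fun k => Cmult (c k) (Cpow z k)) n)%C
  <= Cmod z ^ (S n) * Series (fun j => Cmod (c (S n + j)%nat) * rho ^ j).
Proof.
  intros H Hr Hz.
  assert (Hd : in_disk z) by (unfold in_disk; lra).
  pose proof (has_expansion_series _ _ _ H Hd) as S0.
  rewrite <- Series_scal_l.
  apply Cmod_series_le with (fun j => Cmult (c (S n + j)%nat) (Cpow z (S n + j))).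
  - apply (is_series_incr_n (fun k => Cmult (c k) (Cpow z k)) (S n)); [lia|].
    simpl Init.Nat.pred.
    match goal with |- is_series _ ?x => replace x with (u z); [exact S0|] end.
    set (p := sum_n (fun k => Cmult (c k) (Cpow z k)) n).
    change (@eq C (u z) (Cplus (Cminus (u z) p) p)). generalize (u z) (p : C). intros x y.
    ring.
  - intros j. rewrite Cmod_mult, Cmod_pow, pow_add.
    rewrite (Rmult_comm (Cmod z ^ S n)), <- Rmult_assoc, (Rmult_comm _ (Cmod z ^ S n)).
    apply Rmult_le_compat_l; [apply pow_le, Cmod_ge_0|].
    apply Rmult_le_compat_l; [apply Cmod_ge_0|].
    apply pow_incr; split; [apply Cmod_ge_0|exact Hz].
  - apply (ex_series_scal_l (V := R_NormedModule) (Cmod z ^ S n)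
      (fun j => Cmod (c (S n + j)%nat) * rho ^ j)). eapply shifted_summable; eauto.
Qed.

(** * Products and linear combinations of expansions *)

Lemma is_series_mult_bounded (a b A B : nat -> R) (x y : R) :
  is_series a x -> is_series b y ->
  (forall k, Rabs (a k) <= A k) -> (forall k, Rabs (b k) <= B k) ->
  ex_series A -> ex_series B ->
  is_series (fun n => sum_n (fun k => a k * b (n - k)%nat) n) (x * y).
Proof.
  intros Ha Hb HA HB EA EB.
  apply is_series_ext with (fun n => sum_f_R0 (fun k => a k * b (n - k)%nat) n).
  - intros n. symmetry. apply (sum_n_Reals (fun k => a k * b (n - k)%nat)).
  - apply is_series_mult; auto.
    + apply (ex_series_le (K := R_AbsRing) (V := R_CompleteNormedModule)) with A; auto.
      intros n. change (Rabs (Rabs (a n)) <= A n). rewrite Rabs_Rabsolu. auto.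
    + apply (ex_series_le (K := R_AbsRing) (V := R_CompleteNormedModule)) with B; auto.
      intros n. change (Rabs (Rabs (b n)) <= B n). rewrite Rabs_Rabsolu. auto.
Qed.

Lemma Rabs_Re_le (z : C) : Rabs (Re z) <= Cmod z.
Proof. eapply Rle_trans; [|apply Rmax_Cmod]. apply Rmax_l. Qed.

Lemma Rabs_Im_le (z : C) : Rabs (Im z) <= Cmod z.
Proof. eapply Rle_trans; [|apply Rmax_Cmod]. apply Rmax_r. Qed.

(** The real and imaginary parts of the Cauchy product are combinations of
    four real Cauchy products, each convergent by Mertens' theorem. *)
Lemma Cseries_mult (a b : nat -> C) (x y : C) :
  Cseries a x -> Cseries b y ->
  ex_series (fun k => Cmod (a k)) -> ex_series (fun k => Cmod (b k)) ->
  Cseries (fun n => sum_n (fun k => Cmult (a k) (b (n - k)%nat)) n) (Cmult x y).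
Proof.
  intros Ha Hb EA EB.
  apply Cseries_Re_Im in Ha. apply Cseries_Re_Im in Hb.
  destruct Ha as [Ha1 Ha2], Hb as [Hb1 Hb2].
  assert (M : forall (p q : C -> R) (s t : R),
    (forall z, Rabs (p z) <= Cmod z) -> (forall z, Rabs (q z) <= Cmod z) ->
    is_series (fun k => p (a k)) s -> is_series (fun k => q (b k)) t ->
    is_series (fun n => sum_n (fun k => p (a k) * q (b (n - k)%nat)) n) (s * t)).
  { intros p q s t Hp Hq Hs Ht.
    apply (is_series_mult_bounded (fun k => p (a k)) (fun k => q (b k))
      (fun k => Cmod (a k)) (fun k => Cmod (b k))); auto. }
  pose proof (M Re Re _ _ Rabs_Re_le Rabs_Re_le Ha1 Hb1) as M1.
  pose proof (M Im Im _ _ Rabs_Im_le Rabs_Im_le Ha2 Hb2) as M2.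
  pose proof (M Re Im _ _ Rabs_Re_le Rabs_Im_le Ha1 Hb2) as M3.
  pose proof (M Im Re _ _ Rabs_Im_le Rabs_Re_le Ha2 Hb1) as M4.
  apply Cseries_Re_Im. split.
  - refine (is_series_ext _ _ _ _ (is_series_minus _ _ _ _ M1 M2)).
    intros n. rewrite Re_sum.
    match goal with |- plus ?u (opp ?v) = _ => change (plus u (opp v)) with (u + (opp v : R)) end.
    change (opp (sum_n (fun k => Im (a k) * Im (b (n - k)%nat)) n))
      with (- sum_n (fun k => Im (a k) * Im (b (n - k)%nat)) n).
    replace (- sum_n (fun k => Im (a k) * Im (b (n - k)%nat)) n)
      with ((-1) * sum_n (fun k => Im (a k) * Im (b (n - k)%nat)) n) by ring.
    rewrite <- Rsum_mult_l, <- Rsum_plus. apply sum_n_ext. intros k.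
    unfold Cmult, Re, Im; simpl. Rring.
  - refine (is_series_ext _ _ _ _ (is_series_plus _ _ _ _ M3 M4)).
    intros n. rewrite Im_sum.
    match goal with |- plus ?u ?v = _ => change (plus u v) with (u + v) end.
    rewrite <- Rsum_plus. apply sum_n_ext. intros k.
    unfold Cmult, Re, Im; simpl. Rring.
Qed.

Lemma ex_series_expansion_abs u c z : has_expansion u c -> in_disk z ->
  ex_series (fun k => Cmod (Cmult (c k) (Cpow z k))).
Proof.
  intros H Hz. apply ex_series_ext with (fun k => Cmod (c k) * Cmod z ^ k).
  - intros k. now rewrite Cmod_mult, Cmod_pow.
  - eapply abs_summable; [exact H|]. split; [apply Cmod_ge_0|exact Hz].
Qed.

Lemma analytic_mult u v : analytic_in_disk u -> analytic_in_disk v ->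
  analytic_in_disk (fun z => Cmult (u z) (v z)).
Proof.
  intros [a Ha] [b Hb].
  exists (fun n => sum_n (fun k => Cmult (a k) (b (n - k)%nat)) n).
  apply series_has_expansion. intros z Hz.
  refine (is_series_ext _ _ _ _ (Cseries_mult _ _ _ _ (has_expansion_series _ _ _ Ha Hz)
    (has_expansion_series _ _ _ Hb Hz) (ex_series_expansion_abs _ _ _ Ha Hz) 
    (ex_series_expansion_abs _ _ _ Hb Hz))).
  intros n. rewrite Cmult_comm, <- Csum_mult_l. apply sum_n_ext_loc. intros k Hk.
  replace (Cpow z n) with (Cmult (Cpow z k) (Cpow z (n - k))).
  - Cring.
  - rewrite <- Cpow_add_r. f_equal. lia.
Qed.

Lemma analytic_mult_pow u v n : analytic_in_disk u -> analytic_in_disk v ->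
  analytic_in_disk (fun z => Cmult (u z) (Cpow (v z) n)).
Proof.
  intros Hu Hv. induction n.
  - destruct Hu as [c Hc]. exists c. apply has_expansion_ext with u; auto.
    intros z _. simpl. ring.
  - destruct (analytic_mult _ _ IHn Hv) as [c Hc]. exists c.
    apply has_expansion_ext with (2 := Hc). intros z _. rewrite Cpow_S. ring.
Qed.

Lemma has_expansion_minus u v a b : has_expansion u a -> has_expansion v b ->
  has_expansion (fun z => Cminus (u z) (v z)) (fun k => Cminus (a k) (b k)).
Proof.
  intros Ha Hb z Hz.
  exact (@is_pseries_minus C_AbsRing C_NormedModule a b z _ _ (Ha z Hz) (Hb z Hz)).
Qed.

Lemma has_expansion_plus u v a b : has_expansion u a -> has_expansion v b ->
  has_expansion (fun z => Cplus (u z) (v z)) (fun k => Cplus (a k) (b k)).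
Proof.
  intros Ha Hb z Hz.
  exact (@is_pseries_plus C_AbsRing C_NormedModule a b z _ _ (Ha z Hz) (Hb z Hz)).
Qed.

Lemma has_expansion_scal x u a : has_expansion u a ->
  has_expansion (fun z => Cmult x (u z)) (fun k => Cmult x (a k)).
Proof.
  intros Ha z Hz.
  exact (@is_pseries_scal C_AbsRing C_NormedModule x a z _ (Cmult_comm z x) (Ha z Hz)).
Qed.

Lemma has_expansion_sum (u : nat -> C -> C) (a : nat -> nat -> C) n :
  (forall j, has_expansion (u j) (a j)) ->
  has_expansion (fun z => sum_n (fun j => u j z) n) (fun k => sum_n (fun j => a j k) n).
Proof.
  intros H. induction n.
  - intros z Hz. rewrite sum_O. eapply is_pseries_ext; [|apply (H 0%nat z Hz)].
    intros k. now rewrite sum_O.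
  - intros z Hz. rewrite Csum_S. eapply is_pseries_ext; 
      [|exact (has_expansion_plus _ _ _ _ IHn (H (S n)) z Hz)].
    intros k. now rewrite Csum_S.
Qed.

(** * Termwise differentiation *)

(** Induction on k through
    w^(k+2) - z^(k+2) - (k+2)(w-z)z^(k+1)
      = w (w^(k+1) - z^(k+1) - (k+1)(w-z)z^k) + (k+1)(w-z)^2 z^k. *)
Lemma pow_second_order w z rho k : Cmod w <= rho -> Cmod z <= rho ->
  Cmod (Cpow w (S k) - Cpow z (S k) - RtoC (INR (S k)) * (w - z) * Cpow z k)%C
  <= Cmod (w - z)%C ^ 2 * (INR (S k) * (INR k * rho ^ pred k)).
Proof.
  intros Hw Hz. assert (0 <= rho) by (generalize (Cmod_ge_0 z); lra).
  induction k.
  - simpl INR. replace (Cpow w 1 - Cpow z 1 - RtoC 1 * (w - z) * Cpow z 0)%C with (RtoC 0)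
      by (simpl; ring). rewrite Cmod_0. simpl. lra.
  - replace (Cpow w (S (S k)) - Cpow z (S (S k)) - RtoC (INR (S (S k))) * (w - z) * Cpow z (S k))%C
    with (w * (Cpow w (S k) - Cpow z (S k) - RtoC (INR (S k)) * (w - z) * Cpow z k)
          + RtoC (INR (S k)) * (w - z) * (w - z) * Cpow z k)%C.
    2:{ rewrite (S_INR (S k)), RtoC_plus, !Cpow_S. ring. }
    eapply Rle_trans; [apply Cmod_triangle|]. rewrite !Cmod_mult, Cmod_R, Cmod_pow.
    rewrite (Rabs_pos_eq (INR (S k))) by apply pos_INR.
    set (E := Cmod (_ - _ - _)%C) in *. set (d := Cmod (w - z)%C) in *.
    assert (0 <= d) by apply Cmod_ge_0.
    assert (Hp : Cmod z ^ k <= rho ^ k) by (apply pow_incr; split; [apply Cmod_ge_0|auto]).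
    assert (H2 : Cmod w * E <= d ^ 2 * (INR (S k) * (INR k * rho ^ k))).
    { apply Rle_trans with (rho * (d ^ 2 * (INR (S k) * (INR k * rho ^ pred k)))).
      - apply Rmult_le_compat; auto; apply Cmod_ge_0.
      - apply Req_le. destruct k as [|k]; [simpl INR; ring|].
        change (pred (S k)) with k. change (rho ^ S k) with (rho * rho ^ k). ring. }
    assert (0 <= INR k) by apply pos_INR. simpl pred. rewrite !S_INR in *.
    assert (0 <= rho ^ k) by (apply pow_le; auto).
    assert ((INR k + 1) * d * d * Cmod z ^ k <= (INR k + 1) * d * d * rho ^ k).
    { apply Rmult_le_compat_l; auto. apply Rmult_le_pos; auto. apply Rmult_le_pos; auto; lra. }
    assert (0 <= d ^ 2 * ((INR k + 1) * rho ^ k)).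
    { apply Rmult_le_pos; [apply pow2_ge_0|]. apply Rmult_le_pos; lra. }
    nra.
Qed.

Lemma derivative_bound_summable u c rho : has_expansion u c -> 0 <= rho < 1 ->
  ex_series (fun k => Cmod (c (S k)) * (INR (S k) * (INR k * rho ^ pred k))).
Proof.
  intros H Hr. apply ex_series_incr_1.
  set (a := fun k => Cmod (c k)).
  apply ex_series_ext with (fun k => PS_derive (PS_derive a) k * rho ^ k).
  - intros k. unfold PS_derive, a. simpl pred.
    Rring.
  - apply ex_series_in_radius; auto.
    + rewrite !CV_radius_derive. eapply CV_radius_has_expansion; eauto.
    + intros k. unfold PS_derive, a.
      repeat apply Rmult_le_pos; auto using pos_INR, Cmod_ge_0.
Qed.

Lemma derivative_summable u c rho : has_expansion u c -> 0 <= rho < 1 ->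
  ex_series (fun k => INR (S k) * Cmod (c (S k)) * rho ^ k).
Proof.
  intros H Hr. 
  apply (ex_series_in_radius (PS_derive (fun k => Cmod (c k)))); auto.
  - rewrite !CV_radius_derive. eapply CV_radius_has_expansion; eauto.
  - intros k. unfold PS_derive.
    repeat apply Rmult_le_pos; auto using pos_INR, Cmod_ge_0.
Qed.

Lemma Cseries_derivative_ex u c z : has_expansion u c -> in_disk z ->
  exists D, Cseries (fun k => Cmult (Cmult (INR (S k)) (c (S k))) (Cpow z k)) D.
Proof.
  intros H Hz.
  apply (ex_series_le (K := C_AbsRing) (V := C_CompleteNormedModule))
    with (fun k => INR (S k) * Cmod (c (S k)) * Cmod z ^ k).
  - intros k. change (Cmod (Cmult (Cmult (INR (S k)) (c (S k))) (Cpow z k)) 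
       <= INR (S k) * Cmod (c (S k)) * Cmod z ^ k).
    rewrite !Cmod_mult, Cmod_R, Cmod_pow, Rabs_pos_eq by apply pos_INR. lra.
  - eapply derivative_summable; [exact H|]. split; [apply Cmod_ge_0|exact Hz].
Qed.

(** Summing the second-order bounds of the monomials; the majorant is the
    second derivative of the series of moduli at rho, which is finite. *)
Lemma first_order_error u c rho w z D : has_expansion u c -> 0 <= rho < 1 ->
  Cmod w <= rho -> Cmod z <= rho ->
  Cseries (fun k => Cmult (Cmult (INR (S k)) (c (S k))) (Cpow z k)) D ->
  Cmod (u w - u z - (w - z) * D)%C
  <= Cmod (w - z)%C ^ 2 *
     Series (fun k => Cmod (c (S k)) * (INR (S k) * (INR k * rho ^ pred k))).
Proof.
  intros H Hr Hw Hz HD. rewrite <- Series_scal_l.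
  assert (Dw : in_disk w) by (unfold in_disk; lra).
  assert (Dz : in_disk z) by (unfold in_disk; lra).
  assert (T : forall v, in_disk v -> Cseries (fun k => Cmult (c (S k)) (Cpow v (S k))) (u v - c 0%nat)%C).
  { intros v Hv. apply (is_series_incr_1 (fun k => Cmult (c k) (Cpow v k))).
    match goal with |- is_series _ ?x => replace x with (u v);
      [exact (has_expansion_series _ _ _ H Hv)|] end.
    change (u v = (u v - c 0%nat + c 0%nat * 1)%C :> C). ring. }
  apply Cmod_series_le with (fun k => Cmult (c (S k)) 
     (Cpow w (S k) - Cpow z (S k) - RtoC (INR (S k)) * (w - z) * Cpow z k)%C).
  - pose proof (is_series_minus _ _ _ _ (T w Dw) (T z Dz)) as S1.
    pose proof (is_series_scal (w - z)%C _ _ HD) as S2.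
    pose proof (is_series_minus _ _ _ _ S1 S2) as S3.
    unfold Cseries.
    match type of S3 with is_series _ ?y => match goal with |- is_series _ ?x => 
      replace x with y end end.
    + refine (is_series_ext _ _ _ _ S3). intros k.
      match goal with |- _ = ?t => 
      change ((c (S k) * Cpow w (S k) + - (c (S k) * Cpow z (S k)) + 
         - ((w - z) * (INR (S k) * c (S k) * Cpow z k)))%C = t :> C) end. ring.
    + match goal with |- _ = ?t => 
      change (((u w - c 0%nat) + - (u z - c 0%nat) + - ((w - z) * D))%C = t :> C) end. ring.
  - intros k. rewrite Cmod_mult.
    eapply Rle_trans; [apply Rmult_le_compat_l; [apply Cmod_ge_0|apply pow_second_order; eauto]|].
    apply Req_le. ring.
  - apply (ex_series_scal_l (V := R_NormedModule) (Cmod (w - z)%C ^ 2)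
      (fun k => Cmod (c (S k)) * (INR (S k) * (INR k * rho ^ pred k)))).
    eapply derivative_bound_summable; eauto.
Qed.

Lemma C_derive_series u c z D : has_expansion u c -> in_disk z ->
  Cseries (fun k => Cmult (Cmult (INR (S k)) (c (S k))) (Cpow z k)) D ->
  C_derive u z = D.
Proof.
  intros H Hz HD. apply is_C_derive_unique. unfold in_disk in Hz.
  assert (Hz0 := Cmod_ge_0 z).
  set (rho := (1 + Cmod z) / 2).
  set (K := Series (fun k => Cmod (c (S k)) * (INR (S k) * (INR k * rho ^ pred k)))).
  assert (HK : 0 <= K).
  { unfold K. rewrite <- (Rmult_0_l (Series (fun k => 0))), <- Series_scal_l.
    apply Series_le.
    - intros k. split; [lra|]. rewrite Rmult_0_l. 
      repeat apply Rmult_le_pos; auto using pos_INR, Cmod_ge_0. apply pow_le. unfold rho; lra.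
    - apply (derivative_bound_summable u c rho H). unfold rho; lra. }
  split; [apply is_linear_scal_l|].
  intros y Hy.
  rewrite <- (@is_filter_lim_locally_unique C_AbsRing (AbsRing_NormedModule C_AbsRing) z y Hy).
  clear y Hy. intros eps.
  assert (Hd : 0 < Rmin (eps / (K + 1)) (rho - Cmod z)).
  { apply Rmin_case; [apply Rdiv_lt_0_compat; [apply eps|lra]|unfold rho; lra]. }
  exists (mkposreal _ Hd). intros w Hw.
  change (Cmod (w - z)%C < Rmin (eps / (K + 1)) (rho - Cmod z)) in Hw.
  change (Cmod ((u w - u z) - (w - z) * D)%C <= eps * Cmod (w - z)%C).
  assert (H1 : Cmod (w - z)%C < eps / (K + 1)) by (eapply Rlt_le_trans; [exact Hw|apply Rmin_l]).
  assert (H2 : Cmod (w - z)%C < rho - Cmod z) by (eapply Rlt_le_trans; [exact Hw|apply Rmin_r]).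
  eapply Rle_trans; [apply (first_order_error u c rho w z D); auto|].
  - unfold rho; lra.
  - replace w with ((w - z) + z)%C by ring. eapply Rle_trans; [apply Cmod_triangle|lra].
  - unfold rho; lra.
  - fold K. assert (0 <= Cmod (w - z)%C) by apply Cmod_ge_0.
    assert (Cmod (w - z)%C * (K + 1) <= eps).
    { apply Rlt_le. apply (Rmult_lt_compat_r (K + 1)) in H1; [|lra].
      replace (eps / (K + 1) * (K + 1)) with (eps : R) in H1 by (field; lra). exact H1. }
    nra.
Qed.

Lemma has_expansion_derive u c : has_expansion u c ->
  has_expansion (C_derive u) (fun k => Cmult (INR (S k)) (c (S k))).
Proof.
  intros H. apply series_has_expansion. intros z Hz.
  destruct (Cseries_derivative_ex u c z H Hz) as [D HD].
  now rewrite (C_derive_series u c z D H Hz HD).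
Qed.

Definition expi (t : R) : C := (cos t, sin t).

(** * Sums over roots of unity *)

Lemma expi_plus s t : expi (s + t) = Cmult (expi s) (expi t).
Proof. unfold expi, Cmult; simpl. rewrite cos_plus, sin_plus. f_equal; ring. Qed.

Lemma Cmod_expi t : Cmod (expi t) = 1.
Proof.
  unfold Cmod, expi; simpl fst; simpl snd. rewrite <- sqrt_1 at 1. f_equal.
  generalize (sin2_cos2 t). unfold Rsqr. lra.
Qed.

Lemma expi_opp t : expi (- t) = Cconj (expi t).
Proof. unfold expi, Cconj; simpl. now rewrite cos_neg, sin_neg. Qed.

Lemma expi_pow t n : expi (INR n * t) = Cpow (expi t) n.
Proof.
  induction n.
  - simpl. unfold expi. rewrite Rmult_0_l, cos_0, sin_0. reflexivity.
  - rewrite S_INR, Cpow_S, <- IHn, <- expi_plus. f_equal. ring.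
Qed.

Lemma expi_period (l : Z) : expi (IZR l * (2 * PI)) = RtoC 1.
Proof.
  assert (H : forall n, expi (INR n * (2 * PI)) = RtoC 1).
  { intros n. rewrite expi_pow. unfold expi. rewrite cos_2PI, sin_2PI. apply Cpow_1_l. }
  destruct (Z.le_gt_cases 0 l).
  - rewrite <- (Z2Nat.id l), <- INR_IZR_INZ by lia. apply H.
  - replace (IZR l * (2 * PI)) with (- (INR (Z.to_nat (- l)) * (2 * PI))).
    + rewrite expi_opp, H. unfold Cconj, RtoC; simpl. f_equal. ring.
    + rewrite INR_IZR_INZ, Z2Nat.id, opp_IZR by lia. ring.
Qed.

(** From cos t = 1 - 2 sin^2(t/2), where 0 < |t|/2 < PI. *)
Lemma expi_neq_1 t : 0 < Rabs t < 2 * PI -> expi t <> RtoC 1.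
Proof.
  intros H E. assert (C1 : cos t = 1) by (change (fst (expi t) = 1); now rewrite E).
  assert (H1 : cos (Rabs t) = 1).
  { unfold Rabs. destruct (Rcase_abs t); [rewrite cos_neg|]; auto. }
  replace (Rabs t) with (2 * (Rabs t / 2)) in H1 by field. rewrite cos_2a_sin in H1.
  assert (0 < sin (Rabs t / 2)) by (apply sin_gt_0; lra). nra.
Qed.

(** A geometric sum with ratio w <> 1 and w^(N+1) = 1; the bound on |l| is
    what excludes w = 1. *)
Lemma roots_of_unity_sum (l : Z) (N : nat) : l <> 0%Z -> (Z.abs l < Z.of_nat (S N))%Z ->
  sum_n (fun j => expi (IZR l * (INR j * (2 * PI / INR (S N))))) N = RtoC 0 :> C.
Proof.
  intros Hl HN.
  assert (HS : 0 < INR (S N)) by (apply lt_0_INR; lia).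
  set (w := expi (IZR l * (2 * PI / INR (S N)))).
  assert (Hw : w <> RtoC 1).
  { apply expi_neq_1. assert (0 < PI) by apply PI_RGT_0.
    assert (Hq : 0 < 2 * PI / INR (S N)) by (apply Rdiv_lt_0_compat; lra).
    rewrite Rabs_mult, (Rabs_pos_eq (2 * PI / _)) by lra. rewrite <- abs_IZR.
    assert (1 <= IZR (Z.abs l)) by (apply IZR_le; lia).
    assert (H2 : IZR (Z.abs l) < INR (S N)) by (rewrite INR_IZR_INZ; apply IZR_lt; exact HN).
    split; [apply Rmult_lt_0_compat; lra|].
    apply Rmult_lt_reg_r with (/ (2 * PI / INR (S N))); [now apply Rinv_0_lt_compat|].
    field_simplify; lra. }
  assert (G : forall n, Cmult (w - 1)%C (sum_n (fun j => expi (IZR l * (INR j * (2 * PI / INR (S N))))) n)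
     = (Cpow w (S n) - 1)%C).
  { intros n. rewrite (sum_n_ext _ (fun j => Cpow w j)).
    2:{ intros j. unfold w. rewrite <- expi_pow. f_equal. 
        change (?s = ?t) with (s = t :> R). field. lra. }
    induction n; [rewrite sum_O; simpl; ring|].
    rewrite Csum_S, Cmult_plus_distr_l, IHn, !Cpow_S. ring. }
  specialize (G N).
  assert (HwN : Cpow w (S N) = RtoC 1).
  { unfold w. rewrite <- expi_pow.
    replace (INR (S N) * (IZR l * (2 * PI / INR (S N)))) with (IZR l * (2 * PI)) by (field; lra).
    apply expi_period. }
  rewrite HwN in G.
  assert (Hn : (w - 1)%C <> RtoC 0) by (now apply Cminus_eq_contra).
  match goal with |- ?s = _ => 
    replace (s : C) with (/ (w - 1) * ((w - 1) * s))%C by (field; exact Hn) end.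
  rewrite G. field. exact Hn.
Qed.

Lemma sum_const_1 N : sum_n (fun _ => RtoC 1) N = RtoC (INR (S N)) :> C.
Proof.
  induction N; [now rewrite sum_O|].
  rewrite Csum_S, IHN, (S_INR (S N)), RtoC_plus. reflexivity.
Qed.

Lemma Re_kernel (xi e : C) :
  (1 + xi * e / 2 + Cconj (xi * e) / 2)%C = RtoC (1 + Re (xi * e)).
Proof. rewrite RtoC_plus, re_alt. field. Qed.

Definition unity_sum (N : nat) (l : Z) : C :=
  sum_n (fun j => expi (IZR l * (INR j * (2 * PI / INR (S N))))) N.

Lemma unity_sum_eq N l : (Z.abs l < Z.of_nat (S N))%Z ->
  unity_sum N l = if Z.eqb l 0 then RtoC (INR (S N)) else RtoC 0.
Proof.
  intros H. unfold unity_sum. destruct (Z.eqb_spec l 0) as [->|Hl].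
  - rewrite <- sum_const_1. apply sum_n_ext. intros j. rewrite Rmult_0_l.
    unfold expi. now rewrite cos_0, sin_0.
  - now apply roots_of_unity_sum.
Qed.

(** * Coefficient inequalities *)

(** The mean of the trigonometric polynomial against the nonnegative kernel
    W(t) = 1 + Re(xi e^(-ikt)), shifted by e^(-int). The kernel has frequencies
    0, k and -k, so the mean picks out the coefficients of index n, n + k and
    n - k, and the hypothesis on a removes the last one. *)
Lemma trig_poly_kernel_bound (a : nat -> C) (M n k : nat) (K : R) (xi : C) :
  (forall t, Cmod (sum_n (fun m => Cmult (a m) (expi (INR m * t))) M) <= K) ->
  (0 < k)%nat -> (n + k <= M)%nat ->
  (forall m, (m + k = n)%nat -> a m = RtoC 0) -> Cmod xi = 1 ->
  Cmod (a n + xi * a (n + k)%nat / 2)%C <= K.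
Proof.
  intros HK Hk HM Ha Hxi.
  (* All frequencies that occur have modulus at most M + k, so M + k + 1 nodes
     make the discrete mean exact. *)
  set (N := (M + k)%nat).
  set (th := fun j => INR j * (2 * PI / INR (S N))).
  assert (HS : 0 < INR (S N)) by (apply lt_0_INR; lia).
  set (W := fun j => 1 + Re (xi * expi (- (INR k * th j)))%C).
  assert (HW : forall j, 0 <= W j).
  { intros j. unfold W. pose proof (Rabs_Re_le (xi * expi (- (INR k * th j)))%C) as B.
    rewrite Cmod_mult, Hxi, Cmod_expi in B. apply Rabs_le_between in B. lra. }
  assert (HWt : forall j, RtoC (W j) = (1 + xi / 2 * expi (- (INR k * th j)) 
        + Cconj xi / 2 * expi (INR k * th j))%C).
  { intros j. unfold W. rewrite <- Re_kernel.
    rewrite Cmult_conj, <- expi_opp, Ropp_involutive. field. }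
  assert (HWl : forall l : Z,
     sum_n (fun j => Cmult (W j) (expi (IZR l * th j))) N =
     (unity_sum N l + xi / 2 * unity_sum N (l - Z.of_nat k)
      + Cconj xi / 2 * unity_sum N (l + Z.of_nat k))%C).
  { intros l. unfold unity_sum. rewrite <- !Csum_mult_l, <- !Csum_plus.
    apply sum_n_ext. intros j. rewrite HWt. fold (th j).
    replace (IZR (l - Z.of_nat k) * th j) with (IZR l * th j + - (INR k * th j)).
    2:{ rewrite minus_IZR, <- INR_IZR_INZ. ring. }
    replace (IZR (l + Z.of_nat k) * th j) with (IZR l * th j + (INR k * th j)).
    2:{ rewrite plus_IZR, <- INR_IZR_INZ. ring. }
    rewrite !expi_plus. Cring. }
  assert (TW : sum_n W N = INR (S N)).
  { pose proof (HWl 0%Z) as E.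
    rewrite !unity_sum_eq in E by lia.
    destruct (Z.eqb_spec 0 0); [|lia].
    destruct (Z.eqb_spec (0 - Z.of_nat k) 0); [lia|].
    destruct (Z.eqb_spec (0 + Z.of_nat k) 0); [lia|].
    apply (f_equal Re) in E. rewrite Re_sum in E.
    rewrite (sum_n_ext _ W) in E.
    - rewrite E. unfold Re, Cplus, Cmult, Cdiv, RtoC; simpl. ring.
    - intros j. rewrite Rmult_0_l. unfold expi. rewrite cos_0, sin_0. 
      unfold Re, Cmult, RtoC; simpl. Rring. }
  set (F := fun t => sum_n (fun m => Cmult (a m) (expi (INR m * t))) M : C).
  assert (E : sum_n (fun j => Cmult (Cmult (W j) (expi (- (INR n * th j)))) (F (th j))) N
     = (INR (S N) * (a n + xi * a (n + k)%nat / 2))%C).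
  { transitivity (sum_n (fun m => Cmult (a m) (sum_n (fun j => 
        Cmult (W j) (expi (IZR (Z.of_nat m - Z.of_nat n) * th j))) N)) M : C).
    - rewrite (sum_n_ext _ (fun j => sum_n (fun m => Cmult (a m) 
          (Cmult (W j) (expi (IZR (Z.of_nat m - Z.of_nat n) * th j)))) M)).
      + rewrite (sum_n_switch (G := C_AbelianMonoid)). apply sum_n_ext. intros m.
        rewrite Csum_mult_l. reflexivity.
      + intros j. unfold F. rewrite <- Csum_mult_l. apply sum_n_ext. intros m.
        replace (IZR (Z.of_nat m - Z.of_nat n) * th j) with (- (INR n * th j) + INR m * th j).
        * rewrite expi_plus. Cring.
        * rewrite minus_IZR, <- !INR_IZR_INZ. ring.
    - transitivity (sum_n (fun m => Cplus (if Nat.eqb m n then (INR (S N) * a n)%C else RtoC 0)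
         (if Nat.eqb m (n + k) then (INR (S N) * (xi * a (n + k)%nat / 2))%C else RtoC 0)) M : C).
      + apply sum_n_ext_loc. intros m Hm.
        rewrite HWl, !unity_sum_eq by lia.
        destruct (Z.eqb_spec (Z.of_nat m - Z.of_nat n) 0);
        destruct (Z.eqb_spec (Z.of_nat m - Z.of_nat n - Z.of_nat k) 0);
        destruct (Z.eqb_spec (Z.of_nat m - Z.of_nat n + Z.of_nat k) 0);
        destruct (Nat.eqb_spec m n); destruct (Nat.eqb_spec m (n + k)); try lia;
        try subst m; try (rewrite (Ha m) by lia);
        change (?s = ?t) with (s = t :> C); field.
      + rewrite Csum_plus, !Csum_single by lia.
        Cring. }
  apply Rmult_le_reg_l with (INR (S N)); auto.
  rewrite <- (Rabs_pos_eq (INR (S N))) at 1 by lra.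
  rewrite <- Cmod_R, <- Cmod_mult, <- E, <- TW.
  eapply Rle_trans; [apply (Cmod_sum_le _ (fun j => K * W j))|].
  - intros j _. rewrite !Cmod_mult, Cmod_expi, Cmod_R, Rabs_pos_eq, Rmult_1_r, Rmult_comm by apply HW.
    apply Rmult_le_compat_r; [apply HW|apply HK].
  - rewrite Rsum_mult_l. lra.
Qed.

(** Take xi = x conj(y) / |x y|, which gives xi y the argument of x. *)
Lemma align_phase (x y : C) : exists xi : C, Cmod xi = 1 /\
  Cmod (x + xi * y / 2)%C = Cmod x + Cmod y / 2.
Proof.
  assert (H2 : Cmod (RtoC 2) = 2) by (rewrite Cmod_R; apply Rabs_pos_eq; lra).
  assert (N2 : RtoC 2 <> RtoC 0) by (intros E; apply RtoC_inj in E; lra).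
  destruct (Req_dec (Cmod x) 0) as [Hx|Hx].
  { exists (RtoC 1). split; [apply Cmod_1|].
    rewrite Hx. apply Cmod_eq_0 in Hx. subst x. rewrite Cplus_0_l, Cmult_1_l, Cmod_div, H2; auto. lra. }
  destruct (Req_dec (Cmod y) 0) as [Hy|Hy].
  { exists (RtoC 1). split; [apply Cmod_1|].
    rewrite Hy. apply Cmod_eq_0 in Hy. subst y. replace (x + 1 * 0 / 2)%C with x by (field; auto). lra. }
  assert (Px : 0 < Cmod x) by (generalize (Cmod_ge_0 x); lra).
  assert (Py : 0 < Cmod y) by (generalize (Cmod_ge_0 y); lra).
  assert (Nx : RtoC (Cmod x) <> RtoC 0) by (intros E; apply RtoC_inj in E; lra).
  assert (Ny : RtoC (Cmod y) <> RtoC 0) by (intros E; apply RtoC_inj in E; lra).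
  exists (x * Cconj y / (Cmod x * Cmod y))%C. split.
  - rewrite Cmod_div, !Cmod_mult, Cmod_conj, !Cmod_R, !Rabs_pos_eq by 
      (lra || now apply Cmult_neq_0). field. lra.
  - replace (x + x * Cconj y / (Cmod x * Cmod y) * y / 2)%C 
      with (x * RtoC (1 + Cmod y / (2 * Cmod x)))%C.
    + rewrite Cmod_mult, Cmod_R, Rabs_pos_eq.
      * field. lra.
      * apply Rplus_le_le_0_compat; [lra|]. apply Rlt_le, Rdiv_lt_0_compat; lra.
    + rewrite RtoC_plus, RtoC_div, RtoC_mult by lra.
      replace (x * Cconj y / (Cmod x * Cmod y) * y / 2)%C with
        (x * (y * Cconj y) / (Cmod x * Cmod y) / 2)%C by (field; auto).
      rewrite <- Cmod2_conj, RtoC_pow. simpl Cpow. field. auto.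
Qed.

(** On the circle of radius rho the partial sums of u are trigonometric
    polynomials bounded by K + eps, to which [trig_poly_kernel_bound] applies. *)
Lemma coefficient_pair_bound_on_circle u c rho K n k : has_expansion u c -> 0 < rho < 1 ->
  (forall z, Cmod z = rho -> Cmod (u z) <= K) -> (0 < k)%nat ->
  (forall m, (m + k = n)%nat -> c m = RtoC 0) ->
  Cmod (c n) * rho ^ n + Cmod (c (n + k)%nat) * rho ^ (n + k) / 2 <= K.
Proof.
  intros H Hr HK Hk Hc. apply le_epsilon. intros eps Heps.
  set (s := fun i => Cmod (c i) * rho ^ i).
  assert (Es : ex_series s) by (apply (abs_summable u); auto; lra).
  destruct (proj1 (filterlim_locally _ _) (Series_correct s Es) (mkposreal eps Heps)) as [M0 HM0].
  set (M := (M0 + n + k)%nat).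
  specialize (HM0 M ltac:(lia)). change (Rabs (sum_n s M - Series s) < eps) in HM0.
  assert (Tail : rho ^ S M * Series (fun j => Cmod (c (S M + j)%nat) * rho ^ j) = Series s - sum_n s M).
  { rewrite (Series_incr_n s (S M)) by (auto; lia). simpl Init.Nat.pred.
    rewrite sum_n_Reals, <- Series_scal_l.
    match goal with |- ?x = _ + ?y - _ => replace y with x; [ring|] end.
    apply Series_ext. intros j. unfold s. rewrite pow_add. ring. }
  set (a := fun m => Cmult (c m) (Cpow rho m)).
  destruct (align_phase (a n) (a (n + k)%nat)) as (xi & Hxi & Exi).
  assert (Ha : forall m, Cmod (a m) = Cmod (c m) * rho ^ m).
  { intros m. unfold a. rewrite Cmod_mult, Cmod_pow, Cmod_R, Rabs_pos_eq by lra. reflexivity. }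
  rewrite !Ha in Exi. 
  rewrite <- Exi.
  apply (trig_poly_kernel_bound a M n k (K + eps) xi); auto; [|lia|].
  - intros t. set (z := Cmult rho (expi t)).
    assert (Hz : Cmod z = rho).
    { unfold z. rewrite Cmod_mult, Cmod_expi, Cmod_R, Rabs_pos_eq by lra. ring. }
    rewrite (sum_n_ext _ (fun k => Cmult (c k) (Cpow z k))).
    2:{ intros m. unfold a, z. rewrite Cpow_mult_l, expi_pow. Cring. }
    pose proof (taylor_remainder u c rho M z H Hr (Req_le _ _ Hz)) as T.
    rewrite Hz, Tail in T.
    set (P := sum_n (fun k => Cmult (c k) (Cpow z k)) M : C) in *.
    change (Cmod P <= K + eps).
    replace P with (u z + - (u z - P))%C by ring.
    eapply Rle_trans; [apply Cmod_triangle|]. rewrite Cmod_opp.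
    apply Rplus_le_compat; [apply HK, Hz|].
    eapply Rle_trans; [exact T|]. apply Rabs_lt_between in HM0. lra.
  - intros m Hm. unfold a. rewrite (Hc m Hm). ring.
Qed.

(** The case k = n + 1 of the pair bound, where its vanishing condition is void. *)
Lemma cauchy_estimate u c rho K n : has_expansion u c -> 0 < rho < 1 ->
  (forall z, Cmod z = rho -> Cmod (u z) <= K) -> Cmod (c n) * rho ^ n <= K.
Proof.
  intros H Hr HK.
  pose proof (coefficient_pair_bound_on_circle u c rho K n (S n) H Hr HK
    ltac:(lia) ltac:(intros; lia)) as B.
  assert (0 <= Cmod (c (n + S n)%nat) * rho ^ (n + S n)).
  { apply Rmult_le_pos; [apply Cmod_ge_0|apply pow_le; lra]. }
  lra.
Qed.

Lemma pow_bernoulli_le r n : 0 <= r <= 1 -> 1 - INR n * (1 - r) <= r ^ n.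
Proof.
  intros Hr. induction n; [simpl; lra|].
  rewrite S_INR. simpl pow. assert (0 <= INR n) by apply pos_INR.
  assert (r * (1 - INR n * (1 - r)) <= r * r ^ n) by (apply Rmult_le_compat_l; lra).
  assert (0 <= INR n * ((1 - r) * (1 - r))) by (apply Rmult_le_pos; nra). nra.
Qed.

(** Passage to the limit rho -> 1, made explicit by Bernoulli's inequality. *)
Lemma le_from_powers x b n : 0 <= x ->
  (forall rho, 0 < rho < 1 -> x * rho ^ n <= b) -> x <= b.
Proof.
  intros Hx H. apply le_epsilon. intros eps Heps.
  assert (0 <= INR n) by apply pos_INR.
  assert (P : 0 < x * INR n + 1) by nra.
  set (d := Rmin (1 / 2) (eps / (x * INR n + 1))).
  assert (Hd : 0 < d) by (apply Rmin_case; [lra|now apply Rdiv_lt_0_compat]).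
  assert (Hd1 : d <= 1 / 2) by apply Rmin_l.
  assert (Hd2 : d * (x * INR n + 1) <= eps).
  { replace eps with (eps / (x * INR n + 1) * (x * INR n + 1)) by (field; lra).
    apply Rmult_le_compat_r; [lra|apply Rmin_r]. }
  specialize (H (1 - d) ltac:(lra)).
  pose proof (pow_bernoulli_le (1 - d) n ltac:(lra)) as B.
  assert (x * (1 - INR n * (1 - (1 - d))) <= x * (1 - d) ^ n) by (apply Rmult_le_compat_l; lra).
  nra.
Qed.

(** Both powers of rho are at least rho^(n+k), so the limit rho -> 1 can be
    taken in a single power. *)
Lemma coefficient_pair_bound u c b n k : has_expansion u c ->
  (forall z, in_disk z -> Cmod (u z) <= b) -> (0 < k)%nat ->
  (forall m, (m + k = n)%nat -> c m = RtoC 0) ->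
  Cmod (c n) + Cmod (c (n + k)%nat) / 2 <= b.
Proof.
  intros H Hb Hk Hc.
  assert (P1 := Cmod_ge_0 (c n)). assert (P2 := Cmod_ge_0 (c (n + k)%nat)).
  apply (le_from_powers _ _ (n + k)); [lra|].
  intros rho Hr.
  assert (B : Cmod (c n) * rho ^ n + Cmod (c (n + k)%nat) * rho ^ (n + k) / 2 <= b).
  { apply (coefficient_pair_bound_on_circle u); auto.
    intros z Hz. apply Hb. unfold in_disk. lra. }
  assert (rho ^ (n + k) <= rho ^ n).
  { rewrite pow_add. rewrite <- (Rmult_1_r (rho ^ n)) at 2.
    apply Rmult_le_compat_l; [apply pow_le; lra|].
    rewrite <- (pow1 k). apply pow_incr. lra. }
  nra.
Qed.

(** Cauchy's estimate on the circle of radius rho gives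
    |c_m| <= K rho^(M-m), which tends to 0 with rho. *)
Lemma vanishing_coefficients u c delta K M m : has_expansion u c -> 0 < delta < 1 ->
  (forall z, Cmod z <= delta -> Cmod (u z) <= K * Cmod z ^ M) ->
  (m < M)%nat -> c m = RtoC 0.
Proof.
  intros H Hd HK Hm. apply Cmod_eq_0. apply Rle_antisym; [|apply Cmod_ge_0].
  assert (E : forall rho, 0 < rho <= delta -> Cmod (c m) <= K * rho ^ (M - m)).
  { intros rho Hr.
    assert (B : Cmod (c m) * rho ^ m <= K * rho ^ M).
    { apply (cauchy_estimate u); auto; [lra|]. intros z Hz. rewrite <- Hz. apply HK. lra. }
    apply Rmult_le_reg_r with (rho ^ m); [apply pow_lt; lra|].
    rewrite Rmult_assoc, <- pow_add. replace (M - m + m)%nat with M by lia. exact B. }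
  assert (HK0 : 0 <= K).
  { pose proof (E delta ltac:(lra)) as B. pose proof (Cmod_ge_0 (c m)).
    assert (0 < delta ^ (M - m)) by (apply pow_lt; lra). nra. }
  apply le_epsilon. intros eps Heps. rewrite Rplus_0_l.
  set (rho := Rmin delta (eps / (K + 1))).
  assert (0 < rho) by (apply Rmin_case; [lra|apply Rdiv_lt_0_compat; lra]).
  assert (rho <= delta) by apply Rmin_l.
  eapply Rle_trans; [apply (E rho); lra|].
  apply Rle_trans with (K * rho).
  - apply Rmult_le_compat_l; auto. destruct (M - m)%nat eqn:Q; [lia|]. simpl.
    apply Rle_trans with (rho * 1); [|lra]. apply Rmult_le_compat_l; [lra|].
    rewrite <- (pow1 n). apply pow_incr. lra.
  - assert (rho * (K + 1) <= eps).
    { replace eps with (eps / (K + 1) * (K + 1)) by (field; lra).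
      apply Rmult_le_compat_r; [lra|apply Rmin_r]. }
    nra.
Qed.

Lemma expansion_unique u a b n : has_expansion u a -> has_expansion u b -> a n = b n.
Proof.
  intros Ha Hb.
  assert (E : (a n - b n)%C = RtoC 0).
  { apply (vanishing_coefficients _ _ (1/2) 0 (S n) n (has_expansion_minus _ _ _ _ Ha Hb));
      [lra| |lia].
    intros z _. replace (u z - u z)%C with (RtoC 0) by ring. rewrite Cmod_0. lra. }
  now apply Ceq_minus.
Qed.

(** * The Bohr operator and the choice of coefficients *)

Lemma coeffs_spec u : analytic_in_disk u -> has_expansion u (coeffs u).
Proof. intros H. unfold coeffs. apply epsilon_spec. exact H. Qed.

Lemma Bohr_expansion r u c : has_expansion u c -> 
  Bohr r u = Series (fun n => Cmod (c n) * r ^ n).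
Proof.
  intros H. apply Series_ext. intros n.
  rewrite (expansion_unique u (coeffs u) c n); auto. apply coeffs_spec. now exists c.
Qed.

(** * The majorant of the Bohr sum of one derivative *)

Lemma sum_zero_below (t : nat -> R) M : (forall m, (m <= M)%nat -> t m = 0) -> sum_n t M = 0.
Proof.
  induction M; intros H; [rewrite sum_O; apply H; lia|].
  rewrite Rsum_S, IHM, H by (intros; try apply H; lia). Rring.
Qed.

Lemma sum_shift (t : nat -> R) p L : (forall m, (m < p)%nat -> t m = 0) ->
  sum_n t (p + L) = sum_n (fun k => t (p + k)%nat) L.
Proof.
  intros H. induction L.
  - rewrite sum_O, Nat.add_0_r. destruct p; [now rewrite sum_O|].
    rewrite Rsum_S, sum_zero_below by (intros; apply H; lia). Rring.
  - rewrite Nat.add_succ_r, !Rsum_S, IHL, Nat.add_succ_r. reflexivity.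
Qed.

(** The value of the series sum_k (p + k) r^k. *)
Definition arith_geom (r p : R) := p / (1 - r) + r / (1 - r) ^ 2.

(** The remainder after L + 1 terms is the same series started at p + L + 1. *)
Lemma arith_geom_sum r p L : r < 1 ->
  sum_n (fun k => (p + INR k) * r ^ k) L + r ^ (S L) * arith_geom r (p + INR (S L)) = arith_geom r p.
Proof.
  intros Hr. unfold arith_geom. induction L.
  - rewrite sum_O. simpl. field. lra.
  - rewrite Rsum_S. rewrite <- IHL. rewrite (S_INR (S L)).
    change (r ^ S (S L)) with (r * r ^ S L). field. lra.
Qed.

Lemma arith_geom_sum_le r p L : 0 <= r < 1 -> 0 <= p ->
  sum_n (fun k => (p + INR k) * r ^ k) L <= arith_geom r p.
Proof.
  intros Hr Hp. rewrite <- (arith_geom_sum r p L) by lra.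
  assert (0 <= r ^ S L * arith_geom r (p + INR (S L))); [|lra].
  apply Rmult_le_pos; [apply pow_le; lra|]. unfold arith_geom.
  assert (0 <= INR (S L)) by apply pos_INR.
  apply Rplus_le_le_0_compat; apply Rmult_le_pos; try lra; apply Rlt_le, Rinv_0_lt_compat;
   [lra|apply pow_lt; lra].
Qed.

Lemma arith_geom_le r p : 0 <= r <= 1 / 5 -> 0 <= p ->
  arith_geom r p <= 5 / 4 * p + 25 / 16 * r.
Proof.
  intros Hr Hp. unfold arith_geom.
  assert (H : / (1 - r) <= 5 / 4).
  { replace (5 / 4) with (/ (4 / 5)) by field. apply Rinv_le_contravar; lra. }
  assert (0 < / (1 - r)) by (apply Rinv_0_lt_compat; lra).
  replace (r / (1 - r) ^ 2) with (r * (/ (1 - r) * / (1 - r))) by (field; lra).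
  unfold Rdiv. apply Rplus_le_compat; [nra|].
  rewrite (Rmult_comm (25 * / 16)). apply Rmult_le_compat_l; [lra|]. nra.
Qed.

(** For n = 0 the bound |q_m| <= b suffices: b sum_m (m+1) r^m = b / (1-r)^2
    <= 2 b. For n >= 1 put A = |q_n|; dividing by r^(n-1), the terms other than
    the leading n A are bounded by 2 (b - A) (sum_k (n+k) r^k - n), and for
    r <= 1/5 this is at most (b - A)(n/2 + 25 r / 8), hence at most
    n (b - A) + 2 r b. *)
Lemma weighted_power_majorant (q : nat -> C) (b r : R) (n M : nat) :
  0 <= r <= 1 / 5 ->
  (forall m, (m < n)%nat -> q m = RtoC 0) ->
  (forall m, Cmod (q m) <= b) ->
  (forall k, (0 < k)%nat -> Cmod (q n) + Cmod (q (n + k)%nat) / 2 <= b) ->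
  sum_n (fun m => INR (S m) * r ^ m * Cmod (q (S m))) M 
  <= b * (2 * r ^ n + INR n * r ^ pred n).
Proof.
  intros Hr Hq0 Hqb Hq.
  assert (Hb : 0 <= b) by (generalize (Hqb 0%nat) (Cmod_ge_0 (q 0%nat)); lra).
  destruct n as [|p].
  - apply Rle_trans with (b * sum_n (fun k => (1 + INR k) * r ^ k) M).
    + rewrite <- Rsum_mult_l. apply Rsum_le. intros m _. rewrite S_INR.
      assert (0 <= (INR m + 1) * r ^ m).
      { apply Rmult_le_pos; [generalize (pos_INR m); lra|apply pow_le; lra]. }
      rewrite (Rplus_comm 1), (Rmult_comm b). apply Rmult_le_compat_l; auto.
    + apply Rmult_le_compat_l; auto.
      eapply Rle_trans; [apply arith_geom_sum_le; lra|].
      eapply Rle_trans; [apply arith_geom_le; lra|]. simpl. lra.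
  - set (n := S p). set (A := Cmod (q n)).
    assert (HA : 0 <= A) by apply Cmod_ge_0.
    assert (Hd : 0 <= b - A) by (generalize (Hqb n); unfold A; lra).
    assert (Hn : 1 <= INR n) by (unfold n; rewrite S_INR; generalize (pos_INR p); lra).
    set (t := fun m => INR (S m) * r ^ m * Cmod (q (S m))).
    assert (Ht : forall m, (m < p)%nat -> t m = 0).
    { intros m Hm. unfold t. rewrite Hq0 by lia. rewrite Cmod_0. ring. }
    assert (Hrp : 0 <= r ^ p) by (apply pow_le; lra).
    destruct (le_lt_dec p M) as [HM|HM].
    + replace M with (p + (M - p))%nat by lia. rewrite sum_shift by exact Ht.
      generalize (M - p)%nat. intros L.
      assert (S1 : sum_n (fun k => t (p + k)%nat) L <= r ^ p * 
         (2 * (b - A) * sum_n (fun k => (INR n + INR k) * r ^ k) L 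
           + (INR n * A - 2 * INR n * (b - A)))).
      { induction L.
        - rewrite !sum_O. unfold t. rewrite Nat.add_0_r. fold n. fold A. simpl INR. simpl pow.
          apply Req_le. ring.
        - rewrite !Rsum_S.
          assert (T : t (p + S L)%nat <= r ^ p * (2 * (b - A) * ((INR n + INR (S L)) * r ^ S L))).
          { unfold t. replace (S (p + S L)) with (n + S L)%nat by (unfold n; lia).
            rewrite plus_INR, pow_add.
            assert (Q : Cmod (q (n + S L)%nat) <= 2 * (b - A)).
            { specialize (Hq (S L) ltac:(lia)). fold n in Hq. fold A in Hq. lra. }
            assert (0 <= (INR n + INR (S L)) * (r ^ p * r ^ S L)).
            { apply Rmult_le_pos; [generalize (pos_INR (S L)); lra|].
              apply Rmult_le_pos; auto. apply pow_le; lra. }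
            apply Rle_trans with ((INR n + INR (S L)) * (r ^ p * r ^ S L) * (2 * (b - A))).
            - apply Rmult_le_compat_l; auto.
            - apply Req_le; ring. }
          lra. }
      eapply Rle_trans; [exact S1|].
      change (pred n) with p. change (r ^ n) with (r * r ^ p).
      replace (b * (2 * (r * r ^ p) + INR n * r ^ p)) with (r ^ p * (b * (2 * r + INR n))) by ring.
      apply Rmult_le_compat_l; auto.
      assert (B : sum_n (fun k => (INR n + INR k) * r ^ k) L <= 5 / 4 * INR n + 25 / 16 * r).
      { eapply Rle_trans; [apply arith_geom_sum_le; lra|apply arith_geom_le; lra]. }
      assert (2 * (b - A) * sum_n (fun k => (INR n + INR k) * r ^ k) L <=
         2 * (b - A) * (5 / 4 * INR n + 25 / 16 * r)) by (apply Rmult_le_compat_l; lra).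
      assert (0 <= (b - A) * (INR n / 2 - 9 / 8 * r)) by (apply Rmult_le_pos; lra).
      assert (0 <= r * A) by (apply Rmult_le_pos; lra).
      nra.
    + (* The order of vanishing exceeds the truncation: the sum is empty. *)
      rewrite sum_zero_below by (intros; apply Ht; lia).
      apply Rmult_le_pos; auto. change (pred n) with p. change (r ^ n) with (r * r ^ p).
      apply Rplus_le_le_0_compat; [|apply Rmult_le_pos; lra].
      repeat apply Rmult_le_pos; lra.
Qed.

(** * Partial sums of real series *)

Lemma sum_le_Series (a : nat -> R) n : (forall k, 0 <= a k) -> ex_series a ->
  sum_n a n <= Series a.
Proof.
  intros Ha E. rewrite (Series_incr_n a (S n)) by (auto; lia). simpl Init.Nat.pred.
  rewrite sum_n_Reals. 
  assert (0 <= Series (fun k => a (S n + k)%nat)); [|lra].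
  rewrite <- (Rmult_0_l (Series (fun k => 0))), <- Series_scal_l.
  apply Series_le; [intros; rewrite Rmult_0_l; split; [lra|apply Ha]|].
  apply (ex_series_incr_n a (S n)), E.
Qed.

Lemma Series_le_bound (a : nat -> R) B : ex_series a -> (forall n, sum_n a n <= B) -> Series a <= B.
Proof.
  intros E H. 
  exact (is_lim_seq_le (fun n => sum_n a n) (fun _ => B) (Series a) B H (Series_correct a E)
     (is_lim_seq_const B)).
Qed.

Lemma sum_first (a : nat -> R) n : sum_n a (S n) = a 0%nat + sum_n (fun k => a (S k)) n.
Proof.
  induction n; [now rewrite Rsum_S, !sum_O|].
  rewrite Rsum_S, IHn, Rsum_S. Rring.
Qed.

(** * Composition with a Schwarz function *)

(** Any linear bound near 0 will do: it is used only to read off orders of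
    vanishing. *)
Lemma schwarz_linear_bound phi : Schwarz_function phi ->
  exists K, 0 <= K /\ forall z, Cmod z <= 1 / 2 -> Cmod (phi z) <= K * Cmod z.
Proof.
  intros ((c & Hc) & _ & H0).
  set (K := Series (fun j => Cmod (c (1 + j)%nat) * (1 / 2) ^ j)).
  assert (HK : forall z, Cmod z <= 1 / 2 -> Cmod (phi z) <= K * Cmod z).
  { intros z Hz. pose proof (taylor_remainder phi c (1 / 2) 0 z Hc ltac:(lra) Hz) as T.
    rewrite sum_O, <- (has_expansion_0 phi c Hc), H0 in T.
    fold K in T. rewrite pow_1 in T.
    replace (phi z - 0 * Cpow z 0)%C with (phi z) in T by ring. lra. }
  exists K. split; [|exact HK].
  assert (Hh : Cmod (1 / 2)%C = 1 / 2).
  { rewrite <- RtoC_div by lra. rewrite Cmod_R. apply Rabs_pos_eq. lra. }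
  specialize (HK (1 / 2)%C ltac:(lra)). rewrite Hh in HK.
  pose proof (Cmod_ge_0 (phi (1 / 2)%C)). lra.
Qed.

Definition weighted_power (g phi : C -> C) (n : nat) (z : C) : C := Cmult (g z) (Cpow (phi z) n).

Lemma weighted_power_expansion g phi n : analytic_in_disk g -> analytic_in_disk phi ->
  has_expansion (weighted_power g phi n) (coeffs (weighted_power g phi n)).
Proof. intros Hg Hp. apply coeffs_spec. now apply analytic_mult_pow. Qed.

Lemma weighted_power_bound g phi b n : (forall z, in_disk z -> in_disk (phi z)) ->
  (forall z, in_disk z -> Cmod (g z) <= b) ->
  forall z, in_disk z -> Cmod (weighted_power g phi n z) <= b.
Proof.
  intros Hp Hb z Hz. unfold weighted_power. rewrite Cmod_mult, Cmod_pow.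
  assert (Cmod (phi z) ^ n <= 1).
  { rewrite <- (pow1 n). apply pow_incr. split; [apply Cmod_ge_0|apply Rlt_le, Hp, Hz]. }
  assert (0 <= Cmod (phi z) ^ n) by (apply pow_le, Cmod_ge_0).
  specialize (Hb z Hz). assert (0 <= Cmod (g z)) by apply Cmod_ge_0. nra.
Qed.

(** Near 0 the function g phi^n is at most b K^n |z|^n in modulus. *)
Lemma weighted_power_vanish g phi b n m : analytic_in_disk g -> Schwarz_function phi ->
  (forall z, in_disk z -> Cmod (g z) <= b) -> (m < n)%nat ->
  coeffs (weighted_power g phi n) m = RtoC 0.
Proof.
  intros Hg Hp Hb Hm. destruct (schwarz_linear_bound phi Hp) as (K & HK0 & HK).
  apply (vanishing_coefficients (weighted_power g phi n) _ (1 / 2) (b * K ^ n) n); auto; [|lra|].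
  - apply weighted_power_expansion; [exact Hg|apply Hp].
  - intros z Hz. unfold weighted_power. rewrite Cmod_mult, Cmod_pow, Rmult_assoc, <- Rpow_mult_distr.
    apply Rmult_le_compat; auto using Cmod_ge_0.
    + apply pow_le, Cmod_ge_0.
    + apply Hb. unfold in_disk. lra.
    + apply pow_incr. split; [apply Cmod_ge_0|auto].
Qed.

(** The difference of f and the partial sum of h_n g phi^n up to M is g times
    the Taylor remainder of h at phi(z), which is O(z^(M+1)); its coefficients
    up to M therefore vanish. This avoids any rearrangement of double series. *)
Lemma subordination_coefficients f g h phi b cf ch M m :
  has_expansion f cf -> analytic_in_disk g -> has_expansion h ch -> Schwarz_function phi ->
  (forall z : C, in_disk z -> f z = Cmult (g z) (h (phi z))) ->
  (forall z : C, in_disk z -> Cmod (g z) <= b) -> (m <= M)%nat ->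
  cf m = sum_n (fun n => Cmult (ch n) (coeffs (weighted_power g phi n) m)) M.
Proof.
  intros Hf Hg Hh Hp Hfgh Hb Hm.
  destruct (schwarz_linear_bound phi Hp) as (K & HK0 & HK).
  set (R := fun z => Cminus (f z) (sum_n (fun n => Cmult (ch n) (weighted_power g phi n z)) M)).
  assert (HR : has_expansion R (fun m => Cminus (cf m)
     (sum_n (fun n => Cmult (ch n) (coeffs (weighted_power g phi n) m)) M))).
  { apply has_expansion_minus; auto.
    apply (has_expansion_sum (fun n z => Cmult (ch n) (weighted_power g phi n z))
      (fun n m => Cmult (ch n) (coeffs (weighted_power g phi n) m))).
    intros n. apply has_expansion_scal. apply weighted_power_expansion; [exact Hg|apply Hp]. }
  set (Kh := Series (fun j => Cmod (ch (S M + j)%nat) * (1 / 2) ^ j)).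
  assert (HKh : 0 <= Kh).
  { unfold Kh. rewrite <- (Rmult_0_l (Series (fun k => 0))), <- Series_scal_l.
    apply Series_le; [|apply (shifted_summable h); auto; lra].
    intros k. rewrite Rmult_0_l. split; [lra|]. apply Rmult_le_pos; [apply Cmod_ge_0|apply pow_le; lra]. }
  apply Ceq_minus.
  (* For |z| <= delta the point phi(z) lies in the disk of radius 1/2, where the
     remainder of h is controlled. *)
  set (delta := Rmin (1 / 2) (1 / (2 * (K + 1)))).
  assert (D1 : 0 < delta) by (apply Rmin_case; [lra|apply Rdiv_lt_0_compat; lra]).
  assert (D2 : delta <= 1 / 2) by apply Rmin_l.
  assert (D3 : K * delta <= 1 / 2).
  { apply Rle_trans with ((K + 1) * (1 / (2 * (K + 1)))).
    - apply Rmult_le_compat; try lra. apply Rmin_r.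
    - apply Req_le. field. lra. }
  apply (vanishing_coefficients R _ delta (b * (Kh * K ^ S M)) (S M) m HR); [lra| |lia].
  intros z Hz. assert (Dz : in_disk z) by (unfold in_disk; lra).
  assert (Hphi : Cmod (phi z) <= K * Cmod z) by (apply HK; lra).
  assert (Hphi2 : Cmod (phi z) <= 1 / 2).
  { eapply Rle_trans; [exact Hphi|]. eapply Rle_trans; [|exact D3]. now apply Rmult_le_compat_l. }
  assert (E : R z = Cmult (g z) (h (phi z) - sum_n (fun n => Cmult (ch n) (Cpow (phi z) n)) M)%C).
  { unfold R. rewrite (Hfgh z Dz).
    replace (sum_n (fun n => Cmult (ch n) (weighted_power g phi n z)) M : C)
      with (Cmult (g z) (sum_n (fun n => Cmult (ch n) (Cpow (phi z) n)) M)); [ring|].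
    rewrite <- Csum_mult_l. apply sum_n_ext. intros n. unfold weighted_power.
    Cring. }
  rewrite E, Cmod_mult.
  replace (b * (Kh * K ^ S M) * Cmod z ^ S M) with (b * ((K * Cmod z) ^ S M * Kh)) by
    (rewrite Rpow_mult_distr; ring).
  apply Rmult_le_compat; auto using Cmod_ge_0.
  eapply Rle_trans; [apply (taylor_remainder h ch (1 / 2)); auto; lra|].
  fold Kh. apply Rmult_le_compat_r; auto. apply pow_incr. split; [apply Cmod_ge_0|auto].
Qed.

Theorem theorem5 (f g h phi : C -> C) (b : R)
  (hf : analytic_in_disk f) (hg : analytic_in_disk g) (hh : analytic_in_disk h)
  (hphi : Schwarz_function phi)
  (hfgh : forall z : C, in_disk z -> f z = Cmult (g z) (h (phi z)))
  (hb : forall z : C, in_disk z -> Cmod (g z) <= b) :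
  forall r : R, 0 <= r <= 1 - sqrt (2 / 3) ->
    Bohr r (C_derive f) <= b * (2 * Bohr r h + Bohr r (C_derive h)).
Proof.
  intros r Hr0.
  (* (4/5)^2 = 16/25 < 2/3. *)
  assert (Hr : 0 <= r <= 1 / 5).
  { assert (4 / 5 <= sqrt (2 / 3)); [|lra].
    rewrite <- (sqrt_pow2 (4 / 5)) by lra. apply sqrt_le_1_alt. lra. }
  clear Hr0.
  destruct hf as [cf Hf], hh as [ch Hh].
  rewrite (Bohr_expansion r _ _ (has_expansion_derive f cf Hf)).
  rewrite (Bohr_expansion r _ _ (has_expansion_derive h ch Hh)).
  rewrite (Bohr_expansion r _ _ Hh).
  assert (Eh := abs_summable h ch r Hh ltac:(lra)).
  assert (Eh' := abs_summable _ _ r (has_expansion_derive h ch Hh) ltac:(lra)).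
  assert (Ef' := abs_summable _ _ r (has_expansion_derive f cf Hf) ltac:(lra)).
  assert (Hb0 : 0 <= b).
  { assert (D : in_disk (RtoC 0)) by (unfold in_disk; rewrite Cmod_0; lra).
    generalize (hb _ D) (Cmod_ge_0 (g (RtoC 0))). lra. }
  (* Bounding partial sums keeps every interchange of summations finite. *)
  apply Series_le_bound; [exact Ef'|]. intros M.
  set (q := fun n => coeffs (weighted_power g phi n)).
  assert (Hq : forall n, has_expansion (weighted_power g phi n) (q n)).
  { intros n. apply weighted_power_expansion; [exact hg|apply hphi]. }
  assert (HqB : forall n z, in_disk z -> Cmod (weighted_power g phi n z) <= b).
  { intros n. apply weighted_power_bound; [apply hphi|exact hb]. }
  assert (Hq0 : forall n m, (m < n)%nat -> q n m = RtoC 0).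
  { intros n m Hm. now apply (weighted_power_vanish g phi b). }
  assert (HT : forall n, sum_n (fun m => INR (S m) * r ^ m * Cmod (q n (S m))) M
     <= b * (2 * r ^ n + INR n * r ^ pred n)).
  { intros n. apply weighted_power_majorant; auto.
    - (* As in Cauchy's estimate, the offset m + 1 makes the vanishing
         condition void. *)
      intros m. pose proof (coefficient_pair_bound _ _ b m (S m) (Hq n) (HqB n)
        ltac:(lia) ltac:(intros; lia)).
      pose proof (Cmod_ge_0 (q n (m + S m)%nat)). lra.
    - intros k Hk. apply (coefficient_pair_bound _ _ b n k (Hq n) (HqB n) Hk).
      intros m Hm. apply Hq0. lia. }
  apply Rle_trans with (sum_n (fun m => sum_n (fun n => 
     Cmod (ch n) * (INR (S m) * r ^ m * Cmod (q n (S m)))) (S M)) M).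
  { apply Rsum_le. intros m Hm.
    rewrite Cmod_mult, Cmod_R, (Rabs_pos_eq (INR (S m))) by apply pos_INR.
    rewrite (subordination_coefficients f g h phi b cf ch (S M) (S m)) by (auto; lia).
    rewrite Rmult_assoc, (Rmult_comm (Cmod _)), <- Rmult_assoc.
    rewrite (sum_n_ext _ (fun n => INR (S m) * r ^ m * (Cmod (ch n) * Cmod (q n (S m))))).
    2:{ intros n. Rring. }
    rewrite Rsum_mult_l. apply Rmult_le_compat_l.
    - apply Rmult_le_pos; [apply pos_INR|apply pow_le; lra].
    - apply Cmod_sum_le. intros n _. rewrite Cmod_mult. apply Rle_refl. }
  rewrite (sum_n_switch (G := R_AbelianMonoid)).
  apply Rle_trans with (sum_n (fun n => b * (2 * (Cmod (ch n) * r ^ n)) 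
     + b * (INR n * Cmod (ch n) * r ^ pred n)) (S M)).
  { apply Rsum_le. intros n _. rewrite Rsum_mult_l.
    eapply Rle_trans; [apply Rmult_le_compat_l; [apply Cmod_ge_0|apply HT]|].
    apply Req_le. ring. }
  rewrite Rsum_plus, !Rsum_mult_l, Rmult_plus_distr_l.
  apply Rplus_le_compat; apply Rmult_le_compat_l; auto.
  - apply Rmult_le_compat_l; [lra|]. apply sum_le_Series; auto.
    intros k. apply Rmult_le_pos; [apply Cmod_ge_0|apply pow_le; lra].
  - rewrite sum_first. simpl (INR 0). rewrite !Rmult_0_l, Rplus_0_l.
    rewrite (sum_n_ext _ (fun n => Cmod (Cmult (INR (S n)) (ch (S n))) * r ^ n)).
    + apply sum_le_Series; auto.
      intros k. apply Rmult_le_pos; [apply Cmod_ge_0|apply pow_le; lra].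
    + intros n. rewrite Cmod_mult, Cmod_R, (Rabs_pos_eq (INR (S n))) by apply pos_INR. reflexivity.
Qed.
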